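(* Let $V$, $A$, $D$, $R$, the auxiliary spaces $V_j$ with $\Pi_j$, $A_j$, $D_j$ and coarse spaces $V_j^c\subset V_j$ ($j=1,\dots,J$) be as in the context, and suppose that: (1) there is a constant $C_{p,2}>0$ such that $\|\sum_{j=1}^J\Pi_jw_j\|_D^2\le C_{p,2}\sum_{j=1}^J\|w_j\|_{D_j}^2$ for all $(w_1,\dots,w_J)\in V_1\times\cdots\times V_J$; (2) there is a constant $C_{p,1}>0$ such that for each $w\in V$ there exists $(w_1,\dots,w_J)\in V_1\times\cdots\times V_J$ with $w=\sum_{j=1}^J\Pi_jw_j$ and $\sum_{j=1}^J\|w_j\|_{A_j}^2\le C_{p,1}\|w\|_A^2$; (3) $N(A_j)\subset V_j^c$ for all $j$. Then the two-level AMG method with coarse space $V_c=\sum_{j=1}^J\Pi_jV_j^c$ converges with a rate $$\|E\|_A^2\le1-\frac{\mu_c}{C_{p,1}\,C_{p,2}\,c^D}.$$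
   Context: $V$ is a finite-dimensional real inner product space with dual $V'$ and pairing $(\cdot,\cdot)$, and $'$ denotes the adjoint; $A:V\to V'$ is symmetric positive semi-definite, $D:V\to V'$ symmetric positive definite. For a symmetric semi-definite $M$, $\|v\|_M^2=(Mv,v)$. $R:V'\to V$ is a smoother whose symmetrization $\bar R=R+R'-R'AR$ is symmetric positive definite (so $\|v\|_A^2\le\|v\|_{\bar R^{-1}}^2$), and $c_D,c^D>0$ are constants with $c_D\|v\|_D^2\le\|v\|_{\bar R^{-1}}^2\le c^D\|v\|_D^2$ for all $v\in V$. $V_1,\dots,V_J$ are finite-dimensional spaces (not necessarily subspaces of $V$) with linear maps $\Pi_j:V_j\to V$ such that $V=\sum_j\Pi_jV_j$. For each $j$, $A_j:V_j\to V_j'$ is symmetric positive semi-definite, with kernel $N(A_j)$, $D_j:V_j\to V_j'$ is symmetric positive definite, $V_j^c\subset V_j$ is a subspace, and $$\mu_j(V_j^c)^{-1}=\max_{v_j\in V_j,\ \|v_j\|_{A_j}\neq0}\ \min_{v_j^c\in V_j^c}\frac{\|v_j-v_j^c\|_{D_j}^2}{\|v_j\|_{A_j}^2},\qquad\mu_c=\min_{1\le j\le J}\mu_j(V_j^c).$$ Two-level method (exact coarse solver, smoother $R$): with $P:V_c\to V$ the inclusion, $A_c=P'AP$ and $A_c^{-1}$ its inverse (pseudo-inverse if singular), the error propagation operator is $E=(I-RA)(I-PA_c^{-1}P'A)$, where $PA_c^{-1}P'A$ is the $(\cdot,\cdot)_A$-orthogonal projection onto $V_c$, $(u,v)_A=(Au,v)$,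 and $\|E\|_A=\max_{\|v\|_A\neq0}\|Ev\|_A/\|v\|_A$.
   Formalization: The rate bound is asserted when V_c + N(A) ≠ V; when V_c + N(A) = V the right-hand side can be negative and the bound false, and the statement there is instead that ‖E‖_A = 0. *)

(* Defs.v *)
From HB Require Import structures.
From mathcomp Require Import all_boot all_order all_algebra.
From mathcomp Require Import classical_sets boolp reals constructive_ereal ereal.

Set Implicit Arguments.
Unset Strict Implicit.
Unset Printing Implicit Defensive.

Import Order.TTheory GRing.Theory Num.Theory.

Local Open Scope classical_set_scope.
Local Open Scope ring_scope.

(* The pairing of f : dual V with v : V is application, f v. *)
Notation dual V := 'Hom(V, _^o).

Section Duality.
Variable K : fieldType.
Implicit Types U V : vectType K.

Definition transpose U V (T : 'Hom(U, V)) : 'Hom(dual V, dual U) :=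
  linfun (fun f : dual V => (f \o T)%VF).

Definition bidual V : 'Hom(V, dual (dual V)) :=
  linfun (fun v => linfun (fun f : dual V => f v)).

(* The adjoint of R : V' -> V as a map V' -> V, by reflexivity of V: the
   transpose of R maps V' to V'', and the inverse of the canonical
   isomorphism V -> V'' brings it back to V.  See smoother_adjE. *)
Definition smoother_adj V (R : 'Hom(dual V, V)) : 'Hom(dual V, V) :=
  ((bidual V)^-1 \o transpose R)%VF.

Lemma transposeE U V (T : 'Hom(U, V)) (f : dual V) (u : U) :
  transpose T f u = f (T u).
Proof.
rewrite /transpose.
have lin : linear (fun f : dual V => (f \o T)%VF).
  by move=> a g h; rewrite comp_lfunDl comp_lfunZl.
pose isl := GRing.isLinear.Build _ _ _ _ (fun f : dual V => (f \o T)%VF) lin.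
pose F : {linear dual V -> dual U} :=
  HB.pack (fun f : dual V => (f \o T)%VF) isl.
by rewrite (lfunE F) /= comp_lfunE.
Qed.

Lemma bidualE V (v : V) (f : dual V) : bidual V v f = f v.
Proof.
pose e (v : V) := fun f : dual V => f v.
have elin w : linear (e w : dual V -> K^o).
  by move=> a g h; rewrite /e add_lfunE scale_lfunE.
pose E w : {linear dual V -> K^o} :=
  HB.pack (e w) (GRing.isLinear.Build _ _ _ _ (e w : dual V -> K^o) (elin w)).
have Elin : linear (fun w => linfun (E w)).
  move=> a w x; apply/lfunP=> g.
  by rewrite add_lfunE scale_lfunE !lfunE /= /e linearP.
pose F : {linear V -> dual (dual V)} :=
  HB.pack (fun w => linfun (E w)) (GRing.isLinear.Build _ _ _ _ _ Elin).
have -> : bidual V = linfun F by [].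
by rewrite (lfunE F) /= (lfunE (E v)).
Qed.

Lemma bidual_inj V : lker (bidual V) == 0%VS.
Proof.
rewrite -subv0; apply/subvP=> v; rewrite memv_ker memv0 => /eqP bv0.
apply/eqP; rewrite (coord_vbasis (memvf v)) big1 // => i _.
have := congr1 (fun g : dual (dual V) =>
  g (linfun (coord (vbasis fullv) i : {linear V -> K^o}))) bv0.
by rewrite /= bidualE lfunE /= zero_lfunE => ->; rewrite scale0r.
Qed.

Lemma bidual_surj V : limg (bidual V) = fullv.
Proof.
apply/eqP; rewrite eqEdim subvf /= limg_dim_eq; last first.
  by rewrite (eqP (bidual_inj V)) capv0.
by rewrite !dimvf -[leqRHS]muln1 -[leqRHS]muln1.
Qed.

Lemma smoother_adjE V (R : 'Hom(dual V, V)) (f g : dual V) :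
  f (smoother_adj R g) = g (R f).
Proof.
rewrite -bidualE comp_lfunE /= limg_lfunVK ?transposeE //.
by rewrite bidual_surj memvf.
Qed.

End Duality.

Section Operators.
Variable K : realType.
Implicit Types V : vectType K.

Definition sympsd V (M : 'Hom(V, dual V)) : Prop :=
  (forall u v, M u v = M v u) /\ (forall v, 0 <= M v v).

Definition symspd V (M : 'Hom(V, dual V)) : Prop :=
  (forall u v, M u v = M v u) /\ (forall v, v != 0 -> 0 < M v v).

Definition symspd_dual V (S : 'Hom(dual V, V)) : Prop :=
  (forall f g : dual V, f (S g) = g (S f)) /\ (forall f : dual V, f != 0 -> 0 < f (S f)).

Definition mnorm V (M : 'Hom(V, dual V)) (v : V) : K := Num.sqrt (M v v).

Definition symmetrization V (A : 'Hom(V, dual V)) (R : 'Hom(dual V, V)) :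
    'Hom(dual V, V) :=
  (R + smoother_adj R - (smoother_adj R \o A \o R))%VF.

(* The maximum of a set of nonnegative numbers, with the convention that it
   is 0 for the empty set and +oo for an unbounded set. *)
Definition nnmax (S : set (\bar K)) : \bar K := maxe 0%E (ereal_sup S).

Definition local_mu_inv V (A D : 'Hom(V, dual V)) (Vc : {vspace V}) : \bar K :=
  nnmax [set ereal_inf
      [set (mnorm D (v - vc) ^+ 2 / mnorm A v ^+ 2)%:E
        | vc in [set vc | vc \in Vc]]
    | v in [set v | mnorm A v != 0]].

(* An extended real: local_mu is +oo when local_mu_inv is 0. *)
Definition local_mu V (A D : 'Hom(V, dual V)) (Vc : {vspace V}) : \bar K :=
  ((local_mu_inv A D Vc)^-1)%E.

Definition mu_min (J : nat) (W : 'I_J -> vectType K)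
    (Aj Dj : forall j, 'Hom(W j, dual (W j)))
    (Wc : forall j, {vspace W j}) : \bar K :=
  \big[mine/+oo%E]_(j < J) local_mu (Aj j) (Dj j) (Wc j).

Definition coarse_space V (J : nat) (W : 'I_J -> vectType K)
    (Pi : forall j, 'Hom(W j, V)) (Wc : forall j, {vspace W j}) : {vspace V} :=
  (\sum_(j < J) (Pi j @: Wc j))%VS.

Definition inclusion V (Vc : {vspace V}) : 'Hom(subvs_of Vc, V) :=
  linfun (vsval : subvs_of Vc -> V).

Definition coarse_op V (A : 'Hom(V, dual V)) (Vc : {vspace V}) :
    'Hom(subvs_of Vc, dual (subvs_of Vc)) :=
  (transpose (inclusion Vc) \o A \o inclusion Vc)%VF.

(* For invertible M the only pseudo-inverse is the inverse.  The Moore-Penrose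
   inverse for any choice of inner products is a pseudo-inverse. *)
Definition pseudo_inverse (U V : vectType K) (M : 'Hom(U, V))
    (G : 'Hom(V, U)) : Prop :=
  (M \o G \o M)%VF = M /\ (G \o M \o G)%VF = G.

Definition error_op V (A : 'Hom(V, dual V)) (R : 'Hom(dual V, V))
    (Vc : {vspace V}) (Acinv : 'Hom(dual (subvs_of Vc), subvs_of Vc)) :
    'Hom(V, V) :=
  ((\1 - (R \o A)) \o
   (\1 - (inclusion Vc \o Acinv \o transpose (inclusion Vc) \o A)))%VF.

Definition opnorm V (A : 'Hom(V, dual V)) (E : 'Hom(V, V)) : \bar K :=
  nnmax [set (mnorm A (E v) / mnorm A v)%:E | v in [set v | mnorm A v != 0]].

End Operators.

(* Main.v *)
(* Let Q be the coarse correction, z = Q v, f = A z and S the symmetrized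
   smoother.  Then |E v|_A^2 = |z|_A^2 - f (S f), and z is A-orthogonal to V_c,
   so by Cauchy-Schwarz |z|_A^2 = f (z - c) <= (f (S f))^(1/2) |z - c|_{S^-1}
   for every c in V_c.  Approximating the components of a stable decomposition
   of z in the local coarse spaces gives c with |z - c|_{S^-1}^2 at most
   C1 C2 cD / mu_c |z|_A^2, up to an arbitrarily small error since the local
   minima enter only as infima; hence f (S f) >= mu_c / (C1 C2 cD) |z|_A^2. *)
Require Import Defs.
From HB Require Import structures.
From mathcomp Require Import all_boot all_order all_algebra.
From mathcomp Require Import classical_sets boolp reals constructive_ereal ereal.
From mathcomp Require Import ring.

Set Implicit Arguments.
Unset Strict Implicit.
Unset Printing Implicit Defensive.

Import Order.TTheory GRing.Theory Num.Theory.

Local Open Scope ring_scope.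

(** * Semi-definite forms and the symmetrized smoother *)

Section Forms.
Variable K : realType.
Implicit Types U V : vectType K.

Lemma sympsd_cauchy_schwarz V (M : 'Hom(V, dual V)) (hM : sympsd M) (u v : V) :
  (M u v : K) ^+ 2 <= (M u u : K) * M v v.
Proof.
case: hM => sym psd.
have quad (x y : K) : 0 <= x ^+ 2 * M u u + 2 * (x * y) * M u v + y ^+ 2 * M v v.
  have := psd (x *: u + y *: v).
  rewrite !(linearD, linearZ) /= !(add_lfunE, scale_lfunE) (sym v u).
  rewrite /GRing.scale /= => /le_trans; apply.
  by rewrite le_eqVlt; apply/orP; left; apply/eqP; ring.
have := psd v; rewrite le_eqVlt => /orP[/eqP v0|v_gt0].
  rewrite -v0 mulr0; have [->|uv0] := eqVneq (M u v) 0; first by rewrite expr0n.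
  (* With [M v v = 0] the quadratic is affine in [y]; this [y] gives it the value -1. *)
  have := quad 1 (- (M u u + 1) / (2 * M u v)).
  rewrite -v0.
  have -> : 1 ^+ 2 * M u u + 2 * (1 * (- (M u u + 1) / (2 * M u v))) * M u v +
      (- (M u u + 1) / (2 * M u v)) ^+ 2 * 0 = -1 :> K by field.
  by rewrite ler0N1.
(* The minimizing direction: the quadratic becomes [M v v] times the Cauchy-Schwarz gap. *)
have := quad (M v v) (- M u v).
have -> : (M v v) ^+ 2 * M u u + 2 * (M v v * - M u v) * M u v +
   (- M u v) ^+ 2 * M v v = M v v * (M u u * M v v - M u v ^+ 2) :> K by ring.
by rewrite pmulr_rge0 // subr_ge0.
Qed.

Lemma sympsd_kernel V (M : 'Hom(V, dual V)) (hM : sympsd M) (u v : V) :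
  M u u = 0 -> M u v = 0.
Proof.
move=> u0; have := sympsd_cauchy_schwarz hM u v; rewrite u0 mul0r => le0.
by apply/eqP; rewrite -[_ == _](@sqrf_eq0 K) eq_le le0 sqr_ge0.
Qed.

Lemma sqr_mnorm V (M : 'Hom(V, dual V)) (v : V) :
  0 <= (M v v : K) -> mnorm M v ^+ 2 = M v v.
Proof. exact: sqr_sqrtr. Qed.

Lemma mnorm_eq0 V (M : 'Hom(V, dual V)) (hM : sympsd M) (v : V) :
  (mnorm M v == 0) = (M v v == 0).
Proof. by rewrite -[LHS](@sqrf_eq0 K) sqr_mnorm //; apply: hM.2. Qed.

Section SymspdDual.
Context V (S : 'Hom(dual V, V)).
Hypothesis hS : symspd_dual S.

Lemma symspd_dual_ge0 (f : dual V) : 0 <= (f (S f) : K).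
Proof.
have [->|f0] := eqVneq f 0; first by rewrite zero_lfunE.
exact/ltW/hS.2.
Qed.

(** Definiteness makes [S] injective, and [dual V] has the dimension of [V], so [S] is onto. *)
Lemma symspd_dual_invK (v : V) : S (S^-1%VF v) = v.
Proof.
have ker0 : lker S == 0%VS.
  rewrite -subv0; apply/subvP=> f; rewrite memv_ker memv0 => /eqP Sf0.
  by apply: contraTT isT => f0; have := hS.2 f f0; rewrite Sf0 linear0 ltxx.
apply: limg_lfunVK; suff -> : limg S = fullv by rewrite memvf.
apply/eqP; rewrite eqEdim subvf /= limg_dim_eq; last by rewrite (eqP ker0) capv0.
by rewrite !dimvf -[leqLHS]muln1.
Qed.

Lemma sqr_mnorm_inv (v : V) : mnorm S^-1%VF v ^+ 2 = S^-1%VF v v.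
Proof.
rewrite sqr_mnorm // -[X in S^-1%VF v X]symspd_dual_invK.
exact: symspd_dual_ge0.
Qed.

(** Cauchy-Schwarz on [dual V] for the form [h (S g)], taken at [f] and [S^-1 v]. Composing [S] with
    [bidual V] gives this form the type of the previous inequality. *)
Lemma symspd_dual_cauchy_schwarz (f : dual V) (v : V) :
  (f v : K) ^+ 2 <= (f (S f) : K) * mnorm S^-1%VF v ^+ 2.
Proof.
have bE (g h : dual V) : (bidual V \o S)%VF g h = h (S g).
  by rewrite comp_lfunE bidualE.
have psd : sympsd (bidual V \o S)%VF.
  split=> [g h|g]; rewrite !bE; first exact: hS.1.
  exact: symspd_dual_ge0.
rewrite sqr_mnorm_inv -[X in f X](symspd_dual_invK v).
rewrite -[X in S^-1%VF v X](symspd_dual_invK v).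
have := sympsd_cauchy_schwarz psd f (S^-1%VF v).
by rewrite !bE hS.1.
Qed.

End SymspdDual.

Lemma symmetrizationE V (A : 'Hom(V, dual V)) (R : 'Hom(dual V, V))
    (f g : dual V) :
  f (symmetrization A R g) = f (R g) + g (R f) - A (R g) (R f).
Proof.
rewrite /symmetrization !(add_lfunE, opp_lfunE) linearB linearD /=.
by rewrite [((_ \o A) \o R)%VF _]comp_lfunE [(_ \o A)%VF _]comp_lfunE !smoother_adjE.
Qed.

Lemma smoothing_identity V (A : 'Hom(V, dual V)) (R : 'Hom(dual V, V)) (z : V) :
  sympsd A ->
  A (z - R (A z)) (z - R (A z)) = A z z - A z (symmetrization A R (A z)) :> K.
Proof.
case=> sym _; rewrite symmetrizationE !linearB /= !(add_lfunE, opp_lfunE).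
by rewrite (sym (R (A z)) z); ring.
Qed.

End Forms.

(** * Coarse correction as an A-orthogonal projection, and smoothing after it *)

Section CoarseCorrection.
Variables (K : realType) (V : vectType K) (A : 'Hom(V, dual V)).
Variables (Vc : {vspace V}) (G : 'Hom(dual (subvs_of Vc), subvs_of Vc)).
Hypotheses (hA : sympsd A) (hG : pseudo_inverse (coarse_op A Vc) G).

Definition coarse_correction : 'Hom(V, V) :=
  (\1 - (inclusion Vc \o G \o transpose (inclusion Vc) \o A))%VF.

Local Notation Q := coarse_correction.

Lemma inclusionE (c : subvs_of Vc) : inclusion Vc c = vsval c.
Proof. by rewrite lfunE. Qed.

Lemma coarse_opE (c d : subvs_of Vc) : coarse_op A Vc c d = A (vsval c) (vsval d).
Proof. by rewrite !comp_lfunE transposeE !inclusionE. Qed.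

Lemma coarse_correctionE (v : V) : Q v = v - vsval (G (transpose (inclusion Vc) (A v))).
Proof. by rewrite add_lfunE opp_lfunE id_lfunE !comp_lfunE inclusionE. Qed.

(* With M the coarse operator, g the restriction of A v and G' the adjoint of
   G, (g - M G g)(c) = g (c - G' M c), and c - G' M c lies in ker M. *)
Lemma coarse_correction_orthogonal (v c : V) : c \in Vc -> A (Q v) c = 0.
Proof.
move=> cVc; rewrite -(vsprojK cVc); move: (vsproj Vc c) => {cVc}c.
set M := coarse_op A Vc.
have Msym a b : M a b = M b a by rewrite !coarse_opE hA.1.
have MGM d : M (G (M d)) = M d.
  by have := congr1 (fun F : 'Hom(_, _) => F d) hG.1; rewrite -/M /= !comp_lfunE.
pose k := c - smoother_adj G (M c).
have Mk : M k = 0.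
  apply/lfunP=> d; rewrite zero_lfunE linearB add_lfunE opp_lfunE.
  rewrite (Msym (smoother_adj G _)) smoother_adjE.
  have -> : M c (G (M d)) = M c d.
    by rewrite Msym MGM Msym.
  by rewrite subrr.
(* [M k = 0] gives [k] zero A-seminorm, which puts it in the kernel of [A]. *)
have Ak : A (vsval k) v = 0.
  by apply: sympsd_kernel => //; rewrite -coarse_opE -/M Mk zero_lfunE.
rewrite coarse_correctionE linearB add_lfunE opp_lfunE -coarse_opE -/M.
rewrite Msym -smoother_adjE transposeE inclusionE -linearB -raddfB.
by rewrite -/k /= hA.1.
Qed.

Lemma coarse_correction_mem (v : V) : v - Q v \in Vc.
Proof. by rewrite coarse_correctionE opprB addrC subrK subvsP. Qed.

(** Pythagoras for the A-orthogonal splitting of [v] into [Q v] and [v - Q v]. *)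
Lemma coarse_correction_le (v : V) : (A (Q v) (Q v) : K) <= A v v.
Proof.
have o := coarse_correction_orthogonal v (coarse_correction_mem v).
rewrite -[X in _ <= A X X](subrK (Q v) v); move: (Q v) (v - Q v) o => z p o.
rewrite !linearD /= !add_lfunE (hA.1 p z) o addr0 add0r lerDr.
exact: hA.2.
Qed.

Lemma coarse_correction_eq0 (v : V) :
  (Vc + lker A)%VS = fullv -> A (Q v) (Q v) = 0.
Proof.
move=> full; have : Q v \in (Vc + lker A)%VS by rewrite full memvf.
case/memv_addP=> c cVc [k]; rewrite memv_ker => /eqP Ak0 zE.
rewrite [X in A _ X]zE linearD /= coarse_correction_orthogonal // hA.1 Ak0.
by rewrite zero_lfunE addr0.
Qed.

(** Otherwise every [Q v] would lie in the kernel of [A], and [v = (v - Q v) + Q v] would make the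
    sum full. *)
Lemma coarse_correction_gt0 :
  (Vc + lker A)%VS <> fullv -> exists v, 0 < (A (Q v) (Q v) : K).
Proof.
move=> nfull; apply: contrapT => /forallNP z0; apply: nfull; apply/eqP.
rewrite eqEsubv subvf; apply/subvP=> v _.
rewrite -(subrK (Q v) v) memv_add ?coarse_correction_mem // memv_ker.
apply/eqP/lfunP=> w; rewrite zero_lfunE; apply: sympsd_kernel => //.
by apply/eqP; rewrite eq_le hA.2 andbT leNgt; apply/negP/z0.
Qed.

Lemma error_opE (R : 'Hom(dual V, V)) (v : V) :
  error_op A R G v = Q v - R (A (Q v)).
Proof.
rewrite comp_lfunE -[(\1 - (_ \o A))%VF v]/(Q v) add_lfunE opp_lfunE id_lfunE.
by rewrite comp_lfunE.
Qed.

Section WeakApproximation.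
Variables (R : 'Hom(dual V, V)) (s : K).
Hypotheses (hR : symspd_dual (symmetrization A R)) (s_ge0 : 0 <= s).
Hypothesis approx : forall (z : V) (e : K), 0 < e -> exists2 c, c \in Vc &
  mnorm (symmetrization A R)^-1%VF (z - c) ^+ 2 <= (s + e) * A z z.

Lemma weak_approximation_smoothing (v : V) :
  (A (Q v) (Q v) : K) <= s * A (Q v) (symmetrization A R (A (Q v))).
Proof.
set f := A (Q v); pose y : K := f (symmetrization A R f); pose x : K := f (Q v).
have y_ge0 : 0 <= y := symspd_dual_ge0 hR f.
have : 0 <= x := hA.2 (Q v).
rewrite -/x -/y le_eqVlt => /orP[/eqP <-|x_gt0]; first exact: mulr_ge0.
have bound e : 0 < e -> x <= y * (s + e).
  (* After multiplication by [x] the left side is the square of [f (Q v - c)], ready for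
     Cauchy-Schwarz. *)
  move=> /(approx (Q v))[c cVc le_c]; rewrite -(ler_pM2r x_gt0) -mulrA.
  have xE : f (Q v - c) = x :> K.
    rewrite raddfB -[RHS](subr0 x); congr (_ - _).
    exact: coarse_correction_orthogonal.
  rewrite -expr2 -[in leLHS]xE.
  apply: le_trans (symspd_dual_cauchy_schwarz hR f _) _.
  by rewrite -/y ler_wpM2l.
rewrite leNgt; apply/negP => lt_x.
(* For this [e] the product [y * e] stays below the assumed gap [x - s * y]; the [+ 1] covers
   [y = 0]. *)
have e_gt0 : 0 < (x - s * y) / (y + 1) by rewrite divr_gt0 ?subr_gt0 // ltr_wpDl.
have := bound _ e_gt0; apply/negP; rewrite -ltNge.
have -> : y * (s + (x - s * y) / (y + 1)) = x - (x - s * y) / (y + 1).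
  by field; rewrite gt_eqF // ltr_wpDl.
by rewrite ltrBlDr ltrDl.
Qed.

Lemma weak_approximation_contraction (v : V) : 0 < s ->
  (A (error_op A R G v) (error_op A R G v) : K) <= (1 - s^-1) * A (Q v) (Q v).
Proof.
move=> s_gt0; rewrite error_opE smoothing_identity // mulrBl mul1r lerD2l lerN2.
by rewrite ler_pdivrMl // weak_approximation_smoothing.
Qed.

End WeakApproximation.

End CoarseCorrection.

(** * From quadratic bounds to the operator seminorm *)

Section OperatorNorm.
Variables (K : realType) (V : vectType K) (A : 'Hom(V, dual V)).
Hypothesis hA : sympsd A.

Lemma opnorm_ge0 (E : 'Hom(V, V)) : (0 <= opnorm A E)%E.
Proof. by rewrite /opnorm /nnmax le_max lexx. Qed.

Lemma opnorm_le_sqrt (E : 'Hom(V, V)) (r : K) : 0 <= r ->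
  (forall v, (A (E v) (E v) : K) <= r * A v v) ->
  (opnorm A E <= (Num.sqrt r)%:E)%E.
Proof.
move=> r_ge0 hE; rewrite /opnorm /nnmax ge_max lee_fin sqrtr_ge0 /=.
apply: ge_ereal_sup => _ [v v_neq0 <-]; rewrite lee_fin.
rewrite ler_pdivrMr ?lt_def ?v_neq0 ?sqrtr_ge0 // -sqrtrM //.
exact: ler_wsqrtr.
Qed.

Lemma sqr_opnorm_le (E : 'Hom(V, V)) (r : K) : 0 <= r ->
  (forall v, (A (E v) (E v) : K) <= r * A v v) -> (opnorm A E ^+ 2 <= r%:E)%E.
Proof.
move=> r_ge0 /(opnorm_le_sqrt r_ge0); rewrite -{2}(sqr_sqrtr r_ge0) EFin_expe.
by rewrite lee_sqr // ?opnorm_ge0 // lee_fin sqrtr_ge0.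
Qed.

End OperatorNorm.

(** * Local approximation and its assembly over the auxiliary spaces *)

Section Approximation.
Variable K : realType.

(** If [w] has nonzero A-seminorm, the infimum of its quotients is at most [t], hence below [t + e].
    If not, [w] is in the kernel, so in [Vc], and [c = w] works. *)
Lemma local_approximation (V : vectType K) (A D : 'Hom(V, dual V))
    (Vc : {vspace V}) (t e : K) (w : V) :
  sympsd A -> (lker A <= Vc)%VS -> (local_mu_inv A D Vc <= t%:E)%E -> 0 < e ->
  exists2 c, c \in Vc & mnorm D (w - c) ^+ 2 <= (t + e) * mnorm A w ^+ 2.
Proof.
move=> hA ker_sub; rewrite /local_mu_inv /nnmax ge_max => /andP[_ sup_le] e_gt0.
have [w0|w_neq0] := eqVneq (mnorm A w) 0.
  exists w; last by rewrite w0 subrr /mnorm linear0 sqrtr0 expr0n mulr0.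
  apply: (subvP ker_sub); rewrite memv_ker; apply/eqP/lfunP=> u.
  rewrite zero_lfunE; apply: sympsd_kernel => //.
  by apply/eqP; rewrite -mnorm_eq0 // w0.
have [|_ [c cVc <-]] := @ereal_inf_lt K
    [set (mnorm D (w - vc) ^+ 2 / mnorm A w ^+ 2)%:E
      | vc in [set vc | vc \in Vc]]%classic (t + e)%:E.
  apply: (@le_lt_trans _ _ t%:E); last by rewrite lte_fin ltrDl.
  by apply: le_trans sup_le; apply: ereal_sup_ubound; exists w.
rewrite lte_fin ltr_pdivrMr; first by move/ltW; exists c.
by rewrite exprn_gt0 // lt_def w_neq0 sqrtr_ge0.
Qed.

Section Aggregation.
Variables (V : vectType K) (A D : 'Hom(V, dual V)) (S : 'Hom(dual V, V)).
Variables (J : nat) (W : 'I_J -> vectType K) (Pi : forall j, 'Hom(W j, V)).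
Variables (Aj Dj : forall j, 'Hom(W j, dual (W j))).
Variables (Wc : forall j, {vspace W j}) (cD C1 C2 : K).
Hypotheses (hA : sympsd A) (hAj : forall j, sympsd (Aj j)).
Hypotheses (hcD : 0 < cD) (hC1 : 0 < C1) (hC2 : 0 < C2).
Hypothesis hSD : forall v : V, mnorm S^-1%VF v ^+ 2 <= cD * mnorm D v ^+ 2.
Hypothesis h1 : forall w : (forall j, W j),
  mnorm D (\sum_(j < J) Pi j (w j)) ^+ 2
    <= C2 * \sum_(j < J) mnorm (Dj j) (w j) ^+ 2.
Hypothesis h2 : forall v : V, exists w : (forall j, W j),
  v = \sum_(j < J) Pi j (w j) /\
  \sum_(j < J) mnorm (Aj j) (w j) ^+ 2 <= C1 * mnorm A v ^+ 2.
Hypothesis h3 : forall j, (lker (Aj j) <= Wc j)%VS.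

Lemma coarse_space_approximation (t e : K) (v : V) :
  (forall j, (local_mu_inv (Aj j) (Dj j) (Wc j) <= t%:E)%E) ->
  0 <= t -> 0 < e -> exists2 c, c \in coarse_space Pi Wc &
    mnorm S^-1%VF (v - c) ^+ 2 <= (C1 * C2 * cD * t + e) * A v v.
Proof.
move=> le_t t_ge0 e_gt0; have [w [vE le_w]] := h2 v.
set C := C1 * C2 * cD; have C_gt0 : 0 < C by rewrite !mulr_gt0.
(* The local tolerance: the three stability constants multiply it by [C], back to [e]. *)
have eC_gt0 : 0 < e / C by rewrite divr_gt0.
have [c cWc le_c] := fin_all_exists2
  (fun j => local_approximation (w j) (hAj j) (h3 j) (le_t j) eC_gt0).
exists (\sum_(j < J) Pi j (c j)).
  by apply: memv_sumr => j _; apply: memv_img.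
have -> : v - \sum_(j < J) Pi j (c j) = \sum_(j < J) Pi j (w j - c j).
  by rewrite vE -sumrB; apply: eq_bigr => j _; rewrite linearB.
apply: le_trans (hSD _) _.
apply: (@le_trans _ _ (cD * (C2 * ((t + e / C) * (C1 * mnorm A v ^+ 2))))).
  rewrite ler_pM2l //; apply: le_trans (h1 _) _; rewrite ler_pM2l //.
  apply: (@le_trans _ _ (\sum_(j < J) (t + e / C) * mnorm (Aj j) (w j) ^+ 2)).
    by apply: ler_sum => j _; apply: le_c.
  by rewrite -mulr_sumr ler_wpM2l // addr_ge0 // ltW.
rewrite -[A v v]sqr_mnorm; last exact: hA.2.
have Ce : C * (e / C) = e by rewrite mulrC divfK // gt_eqF.
rewrite -[in leRHS]Ce le_eqVlt; apply/orP; left; apply/eqP.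
by rewrite /C; ring.
Qed.

End Aggregation.

Lemma mu_min_ge0 (J : nat) (W : 'I_J -> vectType K)
    (Aj Dj : forall j, 'Hom(W j, dual (W j))) (Wc : forall j, {vspace W j}) :
  (0 <= mu_min Aj Dj Wc)%E.
Proof.
apply: le_bigmin => [|j _]; first exact: le0y.
by rewrite inve_ge0 /local_mu_inv /nnmax le_max lexx.
Qed.

(** Inversion reverses order on nonnegative extended reals, 0 and +oo included. This gives one bound
    valid for all [j]. *)
Lemma local_mu_inv_le (J : nat) (W : 'I_J -> vectType K)
    (Aj Dj : forall j, 'Hom(W j, dual (W j))) (Wc : forall j, {vspace W j}) j :
  (local_mu_inv (Aj j) (Dj j) (Wc j) <= (mu_min Aj Dj Wc)^-1)%E.
Proof.
have mu_inv_ge0 : (0 <= local_mu_inv (Aj j) (Dj j) (Wc j))%E.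
  by rewrite /local_mu_inv /nnmax le_max lexx.
by rewrite inve_pge ?inE ?mu_min_ge0 //; exact: bigmin_le.
Qed.

End Approximation.

Theorem theorem6p6 (K : realType) (V : vectType K)
    (A D : 'Hom(V, dual V)) (R : 'Hom(dual V, V)) (c_D cD : K)
    (J : nat) (W : 'I_J -> vectType K) (Pi : forall j, 'Hom(W j, V))
    (Aj Dj : forall j, 'Hom(W j, dual (W j))) (Wc : forall j, {vspace W j})
    (Acinv : 'Hom(dual (subvs_of (coarse_space Pi Wc)),
                  subvs_of (coarse_space Pi Wc)))
    (C1 C2 : K)
    (hA : sympsd A) (hD : symspd D)
    (hR : symspd_dual (symmetrization A R))
    (hc_D : 0 < c_D) (hcD : 0 < cD)
    (hRD : forall v : V,
       c_D * mnorm D v ^+ 2 <= mnorm (symmetrization A R)^-1%VF v ^+ 2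
         <= cD * mnorm D v ^+ 2)
    (hJ : (0 < J)%N)
    (hPi : (\sum_(j < J) limg (Pi j))%VS = fullv)
    (hAj : forall j, sympsd (Aj j)) (hDj : forall j, symspd (Dj j))
    (hAcinv : pseudo_inverse (coarse_op A (coarse_space Pi Wc)) Acinv)
    (hC2 : 0 < C2)
    (h1 : forall w : (forall j, W j),
       mnorm D (\sum_(j < J) Pi j (w j)) ^+ 2
         <= C2 * \sum_(j < J) mnorm (Dj j) (w j) ^+ 2)
    (hC1 : 0 < C1)
    (h2 : forall v : V, exists w : (forall j, W j),
       v = \sum_(j < J) Pi j (w j) /\
       \sum_(j < J) mnorm (Aj j) (w j) ^+ 2 <= C1 * mnorm A v ^+ 2)
    (h3 : forall j, (lker (Aj j) <= Wc j)%VS) :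
  (* If V_c together with the kernel of A fills V, then E vanishes in the
     A-seminorm and the right-hand side below can be negative. *)
  ((coarse_space Pi Wc + lker A)%VS <> fullv ->
     (opnorm A (error_op A R Acinv) ^+ 2
        <= 1%:E - mu_min Aj Dj Wc / (C1 * C2 * cD)%:E)%E) /\
  ((coarse_space Pi Wc + lker A)%VS = fullv ->
     opnorm A (error_op A R Acinv) = 0%E).

Proof.
set C := C1 * C2 * cD; have C_gt0 : 0 < C by rewrite !mulr_gt0.
pose Q := coarse_correction A Acinv.
have leQ v : (A (error_op A R Acinv v) (error_op A R Acinv v) : K)
    <= A (Q v) (Q v).
  by rewrite error_opE smoothing_identity // gerBl symspd_dual_ge0.
split=> [nfull|full]; last first.
  apply/eqP; rewrite eq_le opnorm_ge0 andbT -[0%E]/(0%:E) -(sqrtr0 K).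
  apply: opnorm_le_sqrt => // v; rewrite mul0r.
  by apply: le_trans (leQ v) _; rewrite coarse_correction_eq0.
(* This vector rules out an infinite [mu_min] and shows that the rate is nonnegative. *)
have [v0 Qv0_gt0] := coarse_correction_gt0 Acinv hA nfull.
have approx t v (e : K) : (mu_min Aj Dj Wc)^-1%E = t%:E -> 0 <= t -> 0 < e ->
    exists2 c, c \in coarse_space Pi Wc &
      mnorm (symmetrization A R)^-1%VF (v - c) ^+ 2 <= (C * t + e) * A v v.
  move=> tE.
  apply: (coarse_space_approximation (D := D) (Aj := Aj) (Dj := Dj)) => //.
    by move=> u; case/andP: (hRD u).
  by move=> j; rewrite -tE local_mu_inv_le.
have := mu_min_ge0 Aj Dj Wc.
case muE : (mu_min Aj Dj Wc) => [m| |] //; last first.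
  (* An infinite [mu_min] allows [t = 0], which would force [Q v0] to have zero A-seminorm. *)
  move=> _; have t0 : (mu_min Aj Dj Wc)^-1%E = 0%:E by rewrite muE invey.
  have := weak_approximation_smoothing hA hAcinv hR _
    (fun v e => approx 0 v e t0 (lexx 0)) v0.
  by rewrite mulr0 mul0r => /(_ (lexx 0)); rewrite leNgt Qv0_gt0.
rewrite inver (gt_eqF C_gt0) lee_fin le_eqVlt => /orP[/eqP <-|m_gt0].
  (* For [mu_min = 0] the inverse is +oo and gives no finite [t], but the claimed rate is 1: neither
     the coarse correction nor the smoothing increases the A-seminorm. *)
  rewrite mul0e sube0; apply: sqr_opnorm_le => // v; rewrite mul1r.
  exact/(le_trans (leQ v))/coarse_correction_le.
have t0 : (mu_min Aj Dj Wc)^-1%E = (m^-1)%:E by rewrite muE inver gt_eqF.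
have Vm_gt0 : 0 < m^-1 by rewrite invr_gt0.
have Cm_gt0 : 0 < C * m^-1 by rewrite mulr_gt0.
have contr v := weak_approximation_contraction hA hAcinv hR (ltW Cm_gt0)
  (fun v e => approx _ v e t0 (ltW Vm_gt0)) v Cm_gt0.
rewrite invfM invrK mulrC in contr.
(* At [v0] the contraction bounds a nonnegative number by the rate times a positive one. *)
have r_ge0 : 0 <= 1 - m * C^-1.
  by rewrite -(pmulr_lge0 _ Qv0_gt0); apply: le_trans (contr v0); apply: hA.2.
rewrite -EFinM -EFinB; apply: sqr_opnorm_le => // v.
apply: le_trans (contr v) _; rewrite ler_wpM2l //.
exact: coarse_correction_le.
Qed.
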